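(* Let $\mu^y$ be the posterior with negative log-likelihood $\Phi$ and normalization constant $Z$, and for each $N$ let $\Phi_N$ be a random surrogate for $\Phi$ with associated marginal approximate posterior $\mu^{y,N}_{\mathrm{marginal}}$ and normalization constant $Z_N^{\mathrm{marginal}}$ (all as defined in the context). Suppose that there exist scalars $C_1 = C_1(p_1,p_2), C_2 \ge 0$, independent of $N$, such that for Hölder-conjugate exponent pairs $(p_1,p_1')$ and $(p_2,p_2')$ we have, for all $N$, (i) $\left\| \mathbb{E}\left[ \left(\exp(\Phi - \Phi_N)\right)^{p_2} \right]^{1/p_2} \right\|_{L^{2p_1}_{\mu^y}(U)} \le C_1(p_1,p_2)$, where in the case $p_1=\infty$ the outer norm is the standard supremum norm $\|f\|_{L^\infty(U)} = \sup_{u\in U}|f(u)|$; (ii) $C_2^{-1} \le Z_N^{\mathrm{marginal}} \le C_2$. Then there exists a constant $C = C(C_1,C_2,Z)$, independent of $N$, such that for all $N$ $$ d_{\mathrm{Hell}}\left(\mu^y, \mu^{y,N}_{\mathrm{marginal}}\right) \le C \left\| \mathbb{E}\left[ |\Phi - \Phi_N|^{p_2'} \right]^{1/p_2'} \right\|_{L^{2p_1'}_{\mu^y}(U)} . $$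
   Context: Setting (Bayesian inverse problem). $U$ is a separable Banach space, $\mathcal{G}: U \to \mathbb{R}^{d_y}$ is continuous, $\Gamma \in \mathbb{R}^{d_y\times d_y}$ is a symmetric positive definite matrix, $y \in \mathbb{R}^{d_y}$ is fixed data, and $\mu_0$ is a (prior) probability measure on $U$, $\mu_0(U)=1$. Put $\Phi(u) = \frac12 \|y - \mathcal{G}(u)\|_\Gamma^2$, where $\|x\|_\Gamma = \|\Gamma^{-1/2}x\|_2$. The posterior $\mu^y$ is the probability measure on $U$ given by $$\frac{d\mu^y}{d\mu_0}(u) = \frac1Z \exp(-\Phi(u)), \qquad Z = \mathbb{E}_{\mu_0}\left[\exp(-\Phi(u))\right].$$ Random surrogate. For each $N$, $\Phi_N$ is a random real-valued function on $U$ (jointly measurable); $\mathbb{E}$ denotes expectation with respect to the randomness in $\Phi_N$, so that e.g. $\mathbb{E}[|\Phi-\Phi_N|^{q}]^{1/q}$ is the function $u\mapsto \mathbb{E}[|\Phi(u)-\Phi_N(u)|^{q}]^{1/q}$ (essential supremum over the randomness if $q=\infty$). The marginal approximation is the probability measure $$\frac{d\mu^{y,N}_{\mathrm{marginal}}}{d\mu_0}(u) = \frac{1}{Z_N^{\mathrm{marginal}}}\mathbb{E}\left[\exp\left(-\Phi_N(u)\right)\right],\qquad Z_N^{\mathrm{marginal}} = \mathbb{E}_{\mu_0}\left[\mathbb{E}\left[\exp\left(-\Phi_N(u)\right)\right]\right].$$ Hellinger distance: $d_{\mathrm{Hell}}(\mu,\mu') = \left(\frac12\int_U \left(\sqrt{\frac{d\mu}{d\nu}}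 - \sqrt{\frac{d\mu'}{d\nu}}\right)^2 d\nu\right)^{1/2}$ for any measure $\nu$ with respect to which both $\mu$ and $\mu'$ are absolutely continuous (the value does not depend on $\nu$). $L^p_{\mu^y}(U)$ is the $L^p$ space on $U$ with respect to the measure $\mu^y$. Exponents $(p,p')$ are Hölder conjugate if $p,p'\in[1,\infty]$ and $1/p+1/p'=1$. *)

(* Defs.v *)
From HB Require Import structures.
From mathcomp Require Import all_boot all_order all_algebra.
From mathcomp Require Import all_classical all_reals all_analysis.

Set Implicit Arguments.
Unset Strict Implicit.
Unset Printing Implicit Defensive.
Import Order.TTheory GRing.Theory Num.Theory.
Import numFieldNormedType.Exports.

Local Open Scope classical_set_scope.
Local Open Scope ring_scope.

Definition separable_space (T : topologicalType) : Prop :=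
  exists D : set T, countable D /\ dense D.

(* The carrier T equipped with its Borel sigma-algebra. *)
Notation borel T := (g_sigma_algebraType (@open T)).

Definition sympos_def (R : realType) (n : nat) (A : 'M[R]_n) : Prop :=
  A^T = A /\
  forall x : 'cV[R]_n, x != 0 -> 0 < (x^T *m A *m x) ord0 ord0.

(* By the spectral theorem, the set below is a singleton when A is symmetric
   positive definite, so that the default value 0 is not used for such A. *)
Definition sqrtmx (R : realType) (n : nat) (A : 'M[R]_n) : 'M[R]_n :=
  xget 0 [set S : 'M[R]_n | sympos_def S /\ S *m S = A].

(* MathComp-Analysis equips 'cV[R]_n with the max norm. *)
Definition norm2 (R : realType) (n : nat) (x : 'cV[R]_n) : R :=
  Num.sqrt (\sum_(i < n) (x i ord0) ^+ 2).

Definition weighted_norm (R : realType) (n : nat) (Gamma : 'M[R]_n)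
    (x : 'cV[R]_n) : R :=
  norm2 (invmx (sqrtmx Gamma) *m x).

(* The negative log-likelihood Phi. *)
Definition neg_log_lik (R : realType) (U : Type) (n : nat) (Gamma : 'M[R]_n)
    (y : 'cV[R]_n) (G : U -> 'cV[R]_n) (u : U) : R :=
  2^-1 * (weighted_norm Gamma (y - G u)) ^+ 2.

Local Open Scope ereal_scope.

Definition has_density (d : measure_display) (T : measurableType d)
    (R : realType) (mu nu : set T -> \bar R) (f : T -> \bar R) : Prop :=
  forall A : set T, measurable A -> nu A = integral mu A f.

(* The integrand is bounded by 1 when Phi >= 0, hence Z is finite. *)
Definition evidence (d : measure_display) (T : measurableType d)
    (R : realType) (mu0 : probability T R) (Phi : T -> R) : R :=
  fine 'E_mu0[fun u => expR (- Phi u)%R].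

Definition posterior_density (d : measure_display) (T : measurableType d)
    (R : realType) (mu0 : probability T R) (Phi : T -> R) (u : T) : \bar R :=
  ((evidence mu0 Phi)^-1 * expR (- Phi u))%:E.

Definition marginal_lik (d' : measure_display) (W : measurableType d')
    (R : realType) (T : Type) (P : probability W R) (PhiN : T -> W -> R)
    (u : T) : \bar R :=
  'E_P[fun w => expR (- PhiN u w)%R].

(* Extended-valued, as nothing prevents E[exp(- PhiN)] from having an infinite
   prior mean a priori. *)
Definition marginal_evidence (d d' : measure_display) (T : measurableType d)
    (W : measurableType d') (R : realType) (mu0 : probability T R)
    (P : probability W R) (PhiN : T -> W -> R) : \bar R :=
  \int[mu0]_u marginal_lik P PhiN u.

Definition marginal_density (d d' : measure_display) (T : measurableType d)
    (W : measurableType d') (R : realType) (mu0 : probability T R)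
    (P : probability W R) (PhiN : T -> W -> R) (u : T) : \bar R :=
  (marginal_evidence mu0 P PhiN)^-1 * marginal_lik P PhiN u.

(* The Hellinger distance computed with the Radon-Nikodym derivatives with
   respect to nu; meant for nu dominating both mu and mu', in which case the
   value does not depend on nu. *)
Definition hellinger (d : measure_display) (T : measurableType d)
    (R : realType) (nu : {sigma_finite_measure set T -> \bar R})
    (mu mu' : {finite_measure set T -> \bar R}) : \bar R :=
  sqrte (2^-1%:E * \int[nu]_x
    (sqrte (Radon_Nikodym (charge_of_finite_measure mu) nu x) -
     sqrte (Radon_Nikodym (charge_of_finite_measure mu') nu x)) ^+ 2).

(* The norm of L^p(mu), except that for p = +oo the genuine supremum over T
   replaces the essential one. *)
Definition Lnorm_sup (d : measure_display) (T : measurableType d)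
    (R : realType) (mu : {measure set T -> \bar R}) (p : \bar R)
    (f : T -> \bar R) : \bar R :=
  if p == +oo then ereal_sup (range (fun u => `|f u|)) else 'N[mu]_p[f].

Definition conjugate_exponents (R : realType) (p p' : \bar R) : Prop :=
  [/\ 1 <= p, 1 <= p' & p^-1 + p'^-1 = 1].

(* Main.v *)
(** Write r for the density of the marginal approximation with respect to the
    posterior and X(u) = E[exp(Phi(u) - Phi_N(u))], so that X = s^2 r with
    s^2 = Z_N / Z.  For any dominating measure, twice the squared Hellinger
    distance is the posterior mean of (1 - sqrt r)^2.  As r has mean 1, the
    wrong normalisation costs at most a factor 2: the mean of (1 - sqrt r)^2
    is at most twice that of (1 - s sqrt r)^2 = (1 - sqrt X)^2 <= (1 - X)^2.
    Finally |1 - e^x| <= |x| (1 + e^x) and Hoelder's inequality, first in the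
    randomness of Phi_N and then under the posterior, bound the mean of
    (1 - X)^2; the constant 1 + C1 suffices. *)
Require Import Defs.
From HB Require Import structures.
From mathcomp Require Import all_boot all_order all_algebra.
From mathcomp Require Import all_classical all_reals all_analysis.
From mathcomp Require Import measurable_realfun ess_sup_inf ring lra.
Set Implicit Arguments.
Unset Strict Implicit.
Unset Printing Implicit Defensive.
Import Order.TTheory GRing.Theory Num.Theory.
Import numFieldNormedType.Exports.
Local Open Scope classical_set_scope.
Local Open Scope ring_scope.
Local Open Scope ereal_scope.

(** * Conjugate exponents *)

(** Since [+oo^-1 = 0], an infinite exponent forces its partner to be 1. This separates the
    essential-supremum endpoints from the real exponents covered by [hoelder]. *)
Lemma conjugate_exponents_cases (R : realType) (p q : \bar R) :
  conjugate_exponents p q ->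
  [\/ p = +oo /\ q = 1, p = 1 /\ q = +oo |
      exists r s : R, [/\ p = r%:E, q = s%:E, (1 <= r)%R, (1 <= s)%R &
        (r^-1 + s^-1 = 1)%R]].
Proof.
case=> p1 q1 pq.
have [py|py] := eqVneq p +oo.
  by apply: Or31; move: pq; rewrite py invey add0e => /eqP;
    rewrite inve_eq1 => /eqP.
have [qy|qy] := eqVneq q +oo.
  by apply: Or32; move: pq; rewrite qy invey adde0 => /eqP;
    rewrite inve_eq1 => /eqP.
apply: Or33; case: p q p1 q1 pq py qy => [r| |] [s| |] //=;
  rewrite !lee_fin => r1 s1.
rewrite !inver !gt_eqF ?(lt_le_trans ltr01)// => -[rs] _ _.
by exists r, s.
Qed.

Lemma conjugate_exponents_sym (R : realType) (p q : \bar R) :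
  conjugate_exponents p q -> conjugate_exponents q p.
Proof. by case=> p1 q1 pq; split=> //; rewrite addeC. Qed.

(** * Norm inequalities in L^p, endpoints included *)

Section Lnorm_extra.
Context (d : measure_display) (T : measurableType d) (R : realType).
Variable mu : {measure set T -> \bar R}.
Implicit Types (f g : T -> R) (h : T -> \bar R) (p q : \bar R).

(** For real [p] the two integrands agree and 1/p = 2 / (2p). For [p = +oo], squaring is increasing
    on nonnegative values, so it commutes with the essential supremum. *)
Lemma Lnorm_sqr f p : 1 <= p ->
  'N[mu]_p[EFin \o (fun x => f x ^+ 2)%R] = 'N[mu]_(2%:E * p)[EFin \o f] ^+ 2.
Proof.
rewrite unlock; case: p => [r| |//] /=.
  rewrite lee_fin => r1.
  have r0 : r != 0%R by rewrite gt_eqF// (lt_le_trans ltr01).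
  transitivity ((\int[mu]_x (`|(f x)%:E| `^ (2 * r))) `^ r^-1).
    congr (_ `^ _); apply: eq_integral => x _ /=.
    by rewrite normrX powRrM powR_mulrn.
  rewrite -poweRD ?add_neq0_poweRD_def//; first by congr (_ `^ _); field.
  by rewrite -mulr2n mulrn_eq0/= invr_eq0 mulf_neq0.
(* The norm at [+oo] is 0 by definition when the space has measure 0. *)
move=> _; rewrite gt0_muley//; case: ifPn => [mu0|]; last by rewrite mule0.
set M := ess_sup mu (abse \o (EFin \o f)).
have M0 : 0 <= M.
  by apply: ess_sup_gee => //; apply: nearW => x /=; rewrite ?lee_fin.
apply/eqP; rewrite eq_le; apply/andP; split.
  apply/ess_supP; have := ess_sup_ge mu (abse \o (EFin \o f));
    apply: filterS => x /=.
  by rewrite -/M => fM; rewrite normrX EFin_expe lee_sqr.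
set S := ess_sup mu _.
have S0 : 0 <= S.
  by apply: ess_sup_gee => //; apply: nearW => x /=; rewrite ?lee_fin.
rewrite -(sqr_sqrte S0) lee_sqr ?sqrte_ge0//.
apply/ess_supP; have := ess_sup_ge mu (abse \o (EFin \o (fun x => f x ^+ 2)%R)).
apply: filterS => x /=; rewrite -/S => fS.
by rewrite -lee_sqr ?sqrte_ge0 ?sqr_sqrte// -EFin_expe -normrX.
Qed.

Lemma ess_sup_hoelder f g : 0 < mu [set: T] ->
  measurable_fun [set: T] f -> measurable_fun [set: T] g ->
  'N[mu]_1[EFin \o (f \* g)%R] <= 'N[mu]_1[EFin \o f] * 'N[mu]_+oo[EFin \o g].
Proof.
move=> mu0 mf mg; rewrite !Lnorm1 unlock mu0.
set M := ess_sup mu _.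
have M0 : 0 <= M.
  by apply: ess_sup_gee => //; apply: nearW => x /=; rewrite ?lee_fin.
have mfa : measurable_fun [set: T] (abse \o (EFin \o f)).
  by apply: measurableT_comp => //; exact/measurable_EFinP.
rewrite muleC -ge0_integralZl//.
apply: ae_ge0_le_integral => //.
- by apply/measurable_EFinP; apply: measurableT_comp => //;
    exact: measurable_funM.
- by move=> x _; rewrite mule_ge0.
- exact: emeasurable_funM.
- have := ess_sup_ge mu (abse \o (EFin \o g)); apply: filterS => x /= gM _.
  by rewrite normrM EFinM muleC lee_wpmul2r.
Qed.

Lemma ehoelder f g p q : 0 < mu [set: T] -> conjugate_exponents p q ->
  measurable_fun [set: T] f -> measurable_fun [set: T] g ->
  'N[mu]_1[EFin \o (f \* g)%R] <= 'N[mu]_p[EFin \o f] * 'N[mu]_q[EFin \o g].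
Proof.
move=> mu0 /conjugate_exponents_cases.
move=> [[-> ->]|[-> ->]|[r [s [-> -> r1 s1 rs]]]] mf mg.
- rewrite muleC (_ : (f \* g)%R = (g \* f)%R); first exact: ess_sup_hoelder.
  by apply/funext => x /=; rewrite mulrC.
- exact: ess_sup_hoelder.
- by apply: hoelder => //; exact: lt_le_trans ltr01 _.
Qed.

(** Hoelder for f^2 and g^2; by [Lnorm_sqr] their norms are squared norms at doubled exponents,
    hence the exponents 2 p_1 and 2 p_1' of the theorem. *)
Lemma Lnorm2_hoelder f g p q : 0 < mu [set: T] -> conjugate_exponents p q ->
  measurable_fun [set: T] f -> measurable_fun [set: T] g ->
  \int[mu]_x ((f x * g x) ^+ 2)%:E <=
  ('N[mu]_(2%:E * p)[EFin \o f] * 'N[mu]_(2%:E * q)[EFin \o g]) ^+ 2.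
Proof.
move=> mu0 pq mf mg.
have [p1 q1 _] := pq.
have := ehoelder mu0 pq (measurable_funX 2 mf) (measurable_funX 2 mg).
rewrite !Lnorm_sqr// Lnorm1 expe2 !expe2 muleACA; apply: le_trans.
apply: ge0_le_integral => //=.
- by move=> x _; rewrite lee_fin sqr_ge0.
- by apply/measurable_EFinP; exact/measurable_funX/measurable_funM.
- apply/measurable_EFinP/measurableT_comp => //.
  by apply: measurable_funM; exact: measurable_funX.
- by move=> x _; rewrite lee_fin -exprMn ger0_norm ?sqr_ge0.
Qed.

(** The inner norms over the randomness are extended-valued, whereas Hoelder and Minkowski are
    applied to real functions; this passes between the two. *)
Lemma Lnorm_fine h p : 1 <= p -> measurable_fun [set: T] h ->
  (\forall x \ae mu, h x \is a fin_num) ->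
  'N[mu]_p[EFin \o (fine \o h)] = 'N[mu]_p[h].
Proof.
rewrite unlock; case: p => [r| |//] _ mh hfin.
  congr (_ `^ _).
  apply: ge0_ae_eq_integral => //.
  - apply: (measurableT_comp (measurable_poweR r));
      apply: measurableT_comp => //.
    by apply/measurable_EFinP; apply: measurableT_comp.
  - by apply: (measurableT_comp (measurable_poweR r)); apply: measurableT_comp.
  - by move=> x _; exact: poweR_ge0.
  - by move=> x _; exact: poweR_ge0.
  - by apply: filterS hfin => x xfin _ /=; rewrite -[h x in RHS]fineK.
case: ifPn => // _; apply: eq_ess_sup.
by apply: filterS hfin => x xfin /=; rewrite -[h x in RHS]fineK.
Qed.

Lemma Lnorm_lty_fin_num h p : 1 <= p -> measurable_fun [set: T] h ->
  'N[mu]_p[h] < +oo -> \forall x \ae mu, h x \is a fin_num.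
Proof.
rewrite unlock; case: p => [r| |//].
  rewrite lee_fin => r1 mh; have r0 : (0 < r)%R by exact: lt_le_trans ltr01 _.
  move/(lty_poweRy (invr_neq0 (lt0r_neq0 r0))) => fint.
  have : mu.-integrable setT (fun x => `|h x| `^ r).
    apply/integrableP; split.
      by apply: (measurableT_comp (measurable_poweR r));
        apply: measurableT_comp.
    by under eq_integral do rewrite gee0_abs ?poweR_ge0//.
  move/(integrable_ae measurableT); apply: filterS => x /(_ I).
  by case: (h x) => [s|/=|/=] //; rewrite gt_eqF.
move=> _ mh; case: ifPn => [mu0|].
  move=> ltM; have := ess_sup_ge mu (abse \o h); apply: filterS => x /= hM.
  by rewrite fin_num_abs; exact: le_lt_trans hM ltM.
(* For the zero measure the norm says nothing about [h], but the whole space is then negligible. *)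
rewrite -leNgt measure_le0 => /eqP muT0 _.
by exists setT; split.
Qed.

(** Minkowski: on a space of mass 1 the constant 1 has norm 1 for every [p]. *)
Lemma le_Lnorm_add1 f p : 1 <= p -> mu [set: T] = 1 ->
    measurable_fun [set: T] f ->
  'N[mu]_p[EFin \o (fun x => 1 + f x)%R] <= 1 + 'N[mu]_p[EFin \o f].
Proof.
move=> p1 muT mf.
have -> : 1 = 'N[mu]_p[EFin \o (cst 1%R : T -> R)].
  case: p p1 => [r|_|//]; first by rewrite Lnorm_cst1 muT poweR1r.
  by rewrite unlock muT lte01 (ess_sup_ae_cst 1) ?muT ?lte01//;
    apply: nearW => x /=; rewrite normr1.
exact: (@eminkowski _ _ _ mu (fun=> 1%R) f p (measurable_cst _) mf p1).
Qed.

End Lnorm_extra.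

(** * Measurability of inner norms in the outer variable *)

(** The essential supremum of a section exceeds [r] exactly when the section of {f > r} has nonzero
    measure, and the measure of a section is measurable in [x]. *)
Lemma measurable_ess_sup_section (d1 d2 : measure_display)
    (T1 : measurableType d1) (T2 : measurableType d2) (R : realType)
    (P : {sigma_finite_measure set T2 -> \bar R}) (f : T1 * T2 -> \bar R) :
  measurable_fun [set: T1 * T2] f ->
  measurable_fun [set: T1] (fun x => ess_sup P (fun y => f (x, y))).
Proof.
move=> mf; apply: (measurability _ (ErealGenOInfty.measurableE R)).
move=> _ [_ [r ->] <-].
pose A := f @^-1` `]r%:E, +oo[.
have mA : measurable A.
  by rewrite -[A]setTI; apply: mf => //; exact: emeasurable_itv.
have mPA : measurable_fun [set: T1] (P \o xsection A).
  exact: measurable_fun_xsection.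
rewrite setTI (_ : _ @^-1` _ = (P \o xsection A) @^-1` [set~ 0]).
  by rewrite -[X in measurable X]setTI; apply: mPA => //; exact: measurableC.
apply/seteqP; split=> x; rewrite /preimage/= in_itv/= andbT ltNge => xA.
  move=> PA0; move/negP: xA; apply; apply/ess_supP.
  exists (xsection A x); split=> //; first exact: measurable_xsection.
  by move=> y /= /negP; rewrite -ltNge /xsection/= inE /A/= in_itv/= andbT.
apply/negP => /ess_supP[N [mN N0 sub]]; apply: xA.
apply: (subset_measure0 _ mN _ N0); first exact: measurable_xsection.
move=> y; rewrite /xsection/= inE /A/= in_itv/= andbT => ry.
by apply: sub => /=; apply/negP; rewrite -ltNge.
Qed.

Lemma measurable_Lnorm_section (d1 d2 : measure_display)
    (T1 : measurableType d1) (T2 : measurableType d2) (R : realType)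
    (P : {sigma_finite_measure set T2 -> \bar R}) (p : \bar R)
    (f : T1 * T2 -> \bar R) :
  1 <= p -> measurable_fun [set: T1 * T2] f ->
  measurable_fun [set: T1] (fun x => 'N[P]_p[ (fun y => f (x, y)) ]).
Proof.
rewrite unlock; case: p => [r| |//] _ mf.
  apply: (measurableT_comp (measurable_poweR r^-1)).
  apply: (@measurable_fun_fubini_tonelli_F _ _ _ _ _ P (fun z => `|f z| `^ r)).
    by apply: (measurableT_comp (measurable_poweR r)); exact: measurableT_comp.
  by move=> z; exact: poweR_ge0.
case: (0 < P [set: T2]) => [|]; last exact: measurable_cst.
apply: (@measurable_ess_sup_section _ _ _ _ _ P (abse \o f)).
exact: measurableT_comp.
Qed.

(** * The pointwise estimate of 1 - X by Hoelder in the randomness *)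

(** From 1 + t <= e^t: for x >= 0, t = -x gives e^x - 1 <= x e^x; for x < 0, t = x gives 1 - e^x <=
    -x. *)
Lemma ler_norm_1BexpR (R : realType) (x : R) :
  (`|1 - expR x| <= `|x| * (1 + expR x))%R.
Proof.
have e0 := expR_gt0 x.
have [x0|x0] := leP 0%R x.
  rewrite distrC ger0_norm ?subr_ge0; last by rewrite -expR0 ler_expR.
  rewrite ger0_norm//.
  have : (expR x * (1 - x) <= 1)%R.
    rewrite -[leRHS](expRxMexpNx_1 x) ler_pM2l//; exact: expR_ge1Dx.
  lra.
rewrite ger0_norm ?subr_ge0; last by rewrite -expR0 ler_expR ltW.
rewrite ltr0_norm//; have := expR_ge1Dx x; nra.
Qed.

(** As [P] has mass 1, 1 - E[e^x] = E[1 - e^x]; finiteness of E[e^x] ensures that [fine] returns the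
    true mean. After Hoelder, Minkowski splits the 1 off 1 + e^x. *)
Lemma le_abs_1B_integral_expR (d : measure_display) (W : measurableType d)
    (R : realType) (P : probability W R) (x : W -> R) (p q : \bar R) :
  conjugate_exponents p q -> measurable_fun [set: W] x ->
  \int[P]_w (expR (x w))%:E \is a fin_num ->
  (`|1 - fine (\int[P]_w (expR (x w))%:E)|)%:E <=
  'N[P]_q[ (fun w => (`|x w|%R)%:E) ] *
  (1 + 'N[P]_p[ (fun w => (expR (x w))%:E) ]).
Proof.
move=> pq mx Efin.
have [p1 q1 _] := pq.
have mex : measurable_fun [set: W] (expR \o x) by exact: measurableT_comp.
have iexp : P.-integrable [set: W] (EFin \o (expR \o x)).
  apply/integrableP; split; first exact/measurable_EFinP.
  under eq_integral do rewrite /= ger0_norm ?expR_ge0//.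
  by rewrite ltey_eq Efin.
have i1 : P.-integrable [set: W] (EFin \o (fun=> 1%R : R)).
  exact: finite_measure_integrable_cst.
have mabs : measurable_fun [set: W] (fun w => `|x w|%R).
  exact: measurableT_comp.
have m1e : measurable_fun [set: W] (fun w => 1 + expR (x w))%R.
  by apply: measurable_funD.
apply: (@le_trans _ _ (\int[P]_w `|(1 - expR (x w))%:E|)).
  apply: (le_trans _ (le_abse_integral P measurableT _)); last first.
    by apply/measurable_EFinP; exact: measurable_funB.
  under eq_integral do rewrite EFinB.
  rewrite integralB_EFin// integral_cst// mul1e.
  rewrite [X in `|X - _|](probability_setT P).
  by rewrite -[X in _ <= `|1 - X|]fineK.
apply: (@le_trans _ _
    ('N[P]_1[EFin \o ((fun w => `|x w|) \* (fun w => 1 + expR (x w)))%R])).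
  rewrite Lnorm1; apply: ge0_le_integral => //.
  - by apply/measurable_EFinP; apply: measurableT_comp => //;
      exact: measurable_funB.
  - by apply/measurable_EFinP; apply: measurableT_comp => //;
      exact: measurable_funM.
  - move=> w _; rewrite /= lee_fin [leRHS]ger0_norm;
      first exact: ler_norm_1BexpR.
    by rewrite mulr_ge0// addr_ge0// expR_ge0.
have PT : P [set: W] = 1 by exact: probability_setT.
apply: le_trans (ehoelder _ (conjugate_exponents_sym pq) mabs m1e) _.
  by rewrite [X in _ < X]PT.
by rewrite lee_wpmul2l ?Lnorm_ge0//; exact: le_Lnorm_add1.
Qed.

(** * Densities and the Hellinger distance *)

Lemma measurable_fun_sqrt (d : measure_display) (T : measurableType d)
    (R : realType) (f : T -> R) :
  measurable_fun [set: T] f ->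
  measurable_fun [set: T] (fun x => Num.sqrt (f x)).
Proof.
move=> mf; apply: (measurableT_comp _ mf).
exact: continuous_measurable_fun (@sqrt_continuous R).
Qed.

(** [rho] and the Radon-Nikodym derivative have equal integrals over all measurable sets, so they
    agree almost everywhere. *)
Lemma integral_density (d : measure_display) (T : measurableType d)
    (R : realType)
    (mu nu : {finite_measure set T -> \bar R}) (rho f : T -> \bar R)
    (A : set T) :
  measurable_fun [set: T] rho -> (forall x, 0 <= rho x) ->
  has_density mu nu rho ->
  measurable A -> measurable_fun [set: T] f -> (forall x, 0 <= f x) ->
  \int[nu]_(x in A) f x = \int[mu]_(x in A) (f x * rho x).
Proof.
move=> mrho rho0 numu mA mf f0.
have nu_mu : nu `<< mu.
  apply/null_content_dominatesP => B mB B0; rewrite numu//.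
  by apply: null_set_integral => //; exact: measurable_funTS.
have mRN : measurable_fun [set: T] (Radon_Nikodym_SigmaFinite.f nu mu).
  by apply: measurable_int; exact: Radon_Nikodym_SigmaFinite.f_integrable.
have RNrho : ae_eq mu [set: T] (Radon_Nikodym_SigmaFinite.f nu mu) rho.
  apply: integral_ae_eq => //;
    first exact: Radon_Nikodym_SigmaFinite.f_integrable.
  by move=> E _ mE; rewrite -Radon_Nikodym_SigmaFinite.f_integral// numu.
rewrite -(Radon_Nikodym_SigmaFinite.change_of_variables nu_mu f0 mA
  (measurable_funTS mf)).
apply: ae_eq_integral => //.
- exact/measurable_funTS/emeasurable_funM.
- exact/measurable_funTS/emeasurable_funM.
- by apply: filterS RNrho => x E _; rewrite E.
Qed.

(** If f and f' are the derivatives of [mu] and [mu'], then f' = r f almost everywhere for [nu], so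
    (sqrt f - sqrt f')^2 = (1 - sqrt r)^2 f, and f d(nu) is d(mu). *)
Lemma hellinger_density (d : measure_display) (T : measurableType d)
    (R : realType)
    (nu : {sigma_finite_measure set T -> \bar R})
    (mu mu' : {finite_measure set T -> \bar R}) (r : T -> R) :
  mu `<< nu -> mu' `<< nu -> measurable_fun [set: T] r ->
  (forall x, 0 <= r x)%R ->
  has_density mu mu' (EFin \o r) ->
  hellinger nu mu mu' =
    sqrte (2^-1%:E * \int[mu]_x ((1 - Num.sqrt (r x)) ^+ 2)%:E).
Proof.
move=> munu mu'nu mr r0 dens; rewrite /hellinger; congr (sqrte (_ * _)).
set f := Radon_Nikodym (charge_of_finite_measure mu) nu.
set f' := Radon_Nikodym (charge_of_finite_measure mu') nu.
have ffin x : f x \is a fin_num by exact: Radon_Nikodym_fin_num.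
have f'fin x : f' x \is a fin_num by exact: Radon_Nikodym_fin_num.
have mf : measurable_fun [set: T] f.
  by apply: measurable_int; exact: Radon_Nikodym_integrable.
have mf' : measurable_fun [set: T] f'.
  by apply: measurable_int; exact: Radon_Nikodym_integrable.
have f_ge0 : \forall x \ae nu, 0 <= f x.
  have := ae_eq_Radon_Nikodym_SigmaFinite munu measurableT.
  by apply: filterS => x /(_ I) E; rewrite /f -E;
    exact: Radon_Nikodym_SigmaFinite.f_ge0.
have ir : mu.-integrable [set: T] (EFin \o r).
  apply/integrableP; split; first exact/measurable_EFinP.
  under eq_integral do rewrite gee0_abs ?lee_fin//.
  by rewrite -dens// ltey_eq fin_num_measure.
have f'E : ae_eq nu [set: T] f' (fun x => (r x)%:E * f x).
  apply: integral_ae_eq => //; first exact: Radon_Nikodym_integrable.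
    by apply: emeasurable_funM => //; exact/measurable_EFinP.
  move=> E _ mE; rewrite -Radon_Nikodym_integral//
    Radon_Nikodym_change_of_variables//.
    exact: dens.
  exact: integrableS ir.
have sqrteE (y : \bar R) : y \is a fin_num ->
  sqrte y = (Num.sqrt (fine y))%:E by case: y.
have msr : measurable_fun [set: T] (fun x => (1 - Num.sqrt (r x)) ^+ 2)%R.
  by apply: measurable_funX; apply: measurable_funB => //;
    exact: measurable_fun_sqrt.
(* (1 - sqrt r)^2 <= 1 + r, and [r] has the finite integral [mu' setT]. *)
have isr : mu.-integrable [set: T] (fun x => ((1 - Num.sqrt (r x)) ^+ 2)%:E).
  apply: (@le_integrable _ _ _ _ _ measurableT _ (fun x => 1 + (r x)%:E)).
  - exact/measurable_EFinP.
  - move=> x _; rewrite lee_fin !ger0_norm ?sqr_ge0 ?addr_ge0//.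
    have := sqr_sqrtr (r0 x); have := sqrtr_ge0 (r x).
    by move=> s0 sE; rewrite -[in leRHS]sE; nra.
  - apply: integrableD => //; exact: finite_measure_integrable_cst.
rewrite -(Radon_Nikodym_change_of_variables munu measurableT isr).
apply: ae_eq_integral => //.
- rewrite (_ : (fun x => _) =
      EFin \o (fun x => (Num.sqrt (fine (f x)) - Num.sqrt (fine (f' x))) ^+
        2)%R).
    apply/measurable_EFinP/measurable_funX/measurable_funB;
    exact/measurable_fun_sqrt/measurableT_comp.
  by apply/funext => x; rewrite !sqrteE//= expe2 -EFinB -EFinM -expr2.
- by apply: emeasurable_funM => //; exact/measurable_EFinP.
- apply: filterS2 f_ge0 f'E => x fx0 /(_ I) f'x _; rewrite -/f f'x.
  case: (f x) fx0 (ffin x) => // a; rewrite lee_fin => a0 _.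
  rewrite -!EFinM !sqrteE//= sqrtrM// -!EFinM; congr EFin.
  by rewrite -[in RHS](sqr_sqrtr a0); ring.
Qed.

(** * The cost of the wrong normalisation *)

(** With t the mean of sqrt r, the mean of (1 - c sqrt r)^2 is 1 + c^2 - 2ct, so the claim compares
    c = 1 with c = s and reduces to 0 <= t <= 1. *)
Lemma integral_1Bsqrt_le (d : measure_display) (T : measurableType d)
    (R : realType)
    (mu : probability T R) (r : T -> R) (s : R) :
  measurable_fun [set: T] r -> (forall x, 0 <= r x)%R ->
  \int[mu]_x (r x)%:E = 1 ->
  \int[mu]_x ((1 - Num.sqrt (r x)) ^+ 2)%:E <=
  2%:E * \int[mu]_x ((1 - s * Num.sqrt (r x)) ^+ 2)%:E.
Proof.
move=> mr r0 r1.
have ir : mu.-integrable [set: T] (EFin \o r).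
  apply/integrableP; split; first exact/measurable_EFinP.
  by under eq_integral do rewrite gee0_abs ?lee_fin//; rewrite r1 ltry.
have msq := measurable_fun_sqrt mr.
have i1 (c : R) : mu.-integrable [set: T] (cst c%:E).
  exact: finite_measure_integrable_cst.
have isq : mu.-integrable [set: T] (EFin \o (fun x => Num.sqrt (r x))).
  apply: (@le_integrable _ _ _ _ _ measurableT _ (fun x => 1 + (r x)%:E)).
  - exact/measurable_EFinP.
  - move=> x _; rewrite lee_fin !ger0_norm ?sqrtr_ge0 ?addr_ge0//.
    by rewrite -[in leRHS](sqr_sqrtr (r0 x)); have := sqrtr_ge0 (r x); nra.
  - by apply: integrableD => //; exact: (i1 1%R).
pose t := fine (\int[mu]_x (Num.sqrt (r x))%:E).
have tE : \int[mu]_x (Num.sqrt (r x))%:E = t%:E.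
  by rewrite fineK//; exact: integrable_fin_num.
have t0 : (0 <= t)%R.
  by rewrite -lee_fin -tE; apply: integral_ge0 => x _;
    rewrite lee_fin sqrtr_ge0.
have expand (c : R) :
    \int[mu]_x ((1 - c * Num.sqrt (r x)) ^+ 2)%:E = (1 + c ^+ 2 - 2 * c * t)%:E.
  under eq_integral => x _.
    rewrite (_ : (_ ^+ 2)%R = 1 + c ^+ 2 * r x + (- 2 * c) * Num.sqrt (r x))%R;
      last first.
      by have := sqr_sqrtr (r0 x); set q := Num.sqrt _ => <-; ring.
    rewrite !EFinD !EFinM; over.
  rewrite integralD//; last 2 first.
  - by apply: integrableD => //; [exact: i1|exact: integrableZl].
  - by rewrite -EFinM; exact: integrableZl.
  rewrite integralD//; [|exact: i1|exact: integrableZl].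
  rewrite -EFinM !integralZl// r1 tE integral_cst// mul1e.
  rewrite [X in X + _ + _](probability_setT mu).
  by rewrite -!EFinM -!EFinD; congr EFin; ring.
under eq_integral do rewrite -[X in (1 - X)%R]mul1r.
(* At c = 1 the expansion reads 2 - 2t, the integral of a square. *)
have t1 : (t <= 1)%R.
  have : 0 <= \int[mu]_x ((1 - 1 * Num.sqrt (r x)) ^+ 2)%:E.
    by apply: integral_ge0 => x _; rewrite lee_fin sqr_ge0.
  by rewrite expand lee_fin; lra.
rewrite !expand -EFinM lee_fin.
(* The difference of the two sides is 2 ((s - t)^2 + t (1 - t)). *)
by have := sqr_ge0 (s - t)%R; nra.
Qed.

(** * Hoelder under the posterior *)

Lemma Lnorm_le_Lnorm_sup (d : measure_display) (T : measurableType d)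
    (R : realType) (mu : probability T R) (p : \bar R) (f : T -> \bar R) :
  'N[mu]_p[f] <= Lnorm_sup mu p f.
Proof.
rewrite /Lnorm_sup; case: eqP => [->|//].
rewrite unlock [X in 0 < X](probability_setT mu) lte01.
apply/ess_supP; apply: nearW => x /=.
by apply: ereal_sup_ubound; exists x.
Qed.

Lemma integral_sqr_le_Lnorm (d : measure_display) (T : measurableType d)
    (R : realType) (mu : probability T R) (h g : T -> \bar R) (f : T -> R)
    (p q : \bar R) (C : R) :
  conjugate_exponents p q -> (0 <= C)%R ->
  measurable_fun [set: T] h -> measurable_fun [set: T] g ->
  measurable_fun [set: T] f ->
  'N[mu]_(2%:E * p)[g] <= C%:E ->
  (\forall x \ae mu, (`|f x|)%:E <= h x * (1 + g x)) ->
  \int[mu]_x (f x ^+ 2)%:E <= ((1 + C)%:E * 'N[mu]_(2%:E * q)[h]) ^+ 2.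
Proof.
move=> pq C0 mh mg mf gC fhg; have [p1 q1 _] := pq.
have muT : mu [set: T] = 1 by exact: probability_setT.
have le2 (e : \bar R) : 1 <= e -> 1 <= 2%:E * e.
  move=> e1; rewrite -[leLHS]mule1; apply: lee_pmul => //.
  by rewrite lee_fin ler1n.
(* If the norm of [h] is infinite, so is the right-hand side, as 1 + C > 0. Otherwise [h] and [g]
   are finite almost everywhere and can be replaced by their real parts. *)
have := leey 'N[mu]_(2%:E * q)[h]; rewrite le_eqVlt => /predU1P[hoo|hfin].
  by rewrite hoo gt0_muley ?lte_fin ?ltr_wpDr// leey.
have hae := Lnorm_lty_fin_num (le2 _ q1) mh hfin.
have gae := Lnorm_lty_fin_num (le2 _ p1) mg (le_lt_trans gC (ltry _)).
have mfh : measurable_fun [set: T] (fine \o h) by exact: measurableT_comp.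
have mfg : measurable_fun [set: T] (fun x => 1 + fine (g x))%R.
  by apply: measurable_funD => //; exact: measurableT_comp.
apply: (@le_trans _ _ (\int[mu]_x ((fine (h x) * (1 + fine (g x))) ^+ 2)%:E)).
  apply: ae_ge0_le_integral => //.
  - by move=> x _; rewrite lee_fin sqr_ge0.
  - exact/measurable_EFinP/measurable_funX.
  - by move=> x _; rewrite lee_fin sqr_ge0.
  - exact/measurable_EFinP/measurable_funX/measurable_funM.
  - apply: filterS3 hae gae fhg => x hx gx + _.
    rewrite -(fineK hx) -(fineK gx) -EFinD -EFinM !lee_fin/= => le.
    rewrite -[leLHS]real_normK ?num_real// ler_sqr ?nnegrE//.
    exact: le_trans (normr_ge0 _) le.
have mu0 : 0 < mu [set: T] by rewrite [X in _ < X]muT.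
apply: le_trans (Lnorm2_hoelder mu0 (conjugate_exponents_sym pq) mfh mfg) _.
rewrite lee_sqr ?mule_ge0 ?Lnorm_ge0// ?lee_fin ?addr_ge0//.
rewrite muleC Lnorm_fine ?le2// lee_wpmul2r ?Lnorm_ge0//.
apply: le_trans (le_Lnorm_add1 (le2 _ p1) muT _) _;
  first exact: measurableT_comp.
by rewrite (Lnorm_fine (le2 _ p1))// [leRHS]EFinD; apply: leeD.
Qed.

(** Factor 1 - a^2 = (1 - a)(1 + a) with 1 + a >= 1; used with a = sqrt X. *)
Lemma le_sqr_1Bsqr (R : realType) (a : R) : (0 <= a)%R ->
  ((1 - a) ^+ 2 <= (1 - a ^+ 2) ^+ 2)%R.
Proof.
move=> a0; rewrite (_ : 1 - a ^+ 2 = (1 - a) * (1 + a))%R; last by ring.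
rewrite exprMn ler_peMr ?sqr_ge0// -[leLHS](expr1n _ 2).
by rewrite ler_sqr ?nnegrE ?addr_ge0// lerDl.
Qed.

(** * Borel measurability of the negative log-likelihood *)

Lemma continuous_borel_measurable_fun (R : realType)
    (U : completeNormedModType R) (f : U -> R) :
  continuous f -> measurable_fun [set: borel U] f.
Proof.
move=> /continuousP cf; apply: (measurability _ (RGenOInfty.measurableE R)).
move=> _ [_ [x ->] <-]; rewrite setTI; apply: sub_sigma_algebra.
by apply: cf; exact: interval_open.
Qed.

Lemma measurable_neg_log_lik (R : realType) (U : completeNormedModType R)
    (n : nat) (Gamma : 'M[R]_n) (y : 'cV[R]_n) (G : U -> 'cV[R]_n) :
  continuous G -> measurable_fun [set: borel U] (neg_log_lik Gamma y G).
Proof.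
move=> cG; apply: measurable_funM => //; apply: measurable_funX.
apply: measurable_fun_sqrt; apply: measurable_sum => i.
apply: measurable_funX; under eq_fun do rewrite mxE.
apply: measurable_sum => j; apply: measurable_funM => //.
under eq_fun do rewrite !mxE; apply: measurable_funB => //.
apply: continuous_borel_measurable_fun => u.
exact: (continuous_comp (cG u) (@coord_continuous _ _ _ _ _ _)).
Qed.

(** * The bound for one surrogate *)

Lemma hellinger_marginal_le (d d' : measure_display) (T : measurableType d)
    (W : measurableType d') (R : realType) (mu0 muy muyN : probability T R)
    (P : probability W R) (Phi : T -> R) (PhiN : T -> W -> R)
    (p1 p1' p2 p2' : \bar R) (C : R)
    (nu : {sigma_finite_measure set T -> \bar R}) :
  measurable_fun [set: T] Phi ->
  measurable_fun [set: T * W] (fun z => PhiN z.1 z.2) ->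
  has_density mu0 muy (posterior_density mu0 Phi) ->
  has_density mu0 muyN (marginal_density mu0 P PhiN) ->
  conjugate_exponents p1 p1' -> conjugate_exponents p2 p2' -> (0 <= C)%R ->
  0 < marginal_evidence mu0 P PhiN < +oo ->
  'N[muy]_(2%:E * p1)
    [ (fun u => 'N[P]_p2[ (fun w => (expR (Phi u - PhiN u w))%:E) ]) ]
    <= C%:E ->
  muy `<< nu -> muyN `<< nu ->
  hellinger nu muy muyN <= (1 + C)%:E *
    'N[muy]_(2%:E * p1')
      [ (fun u => 'N[P]_p2'[ (fun w => (`|Phi u - PhiN u w|%R)%:E) ]) ].
Proof.
move=> mPhi mPhiN ydens Ndens p1p1' p2p2' C0 /andP[ZN0 ZNoo] gC muynu muyNnu.
have [p2_1 p2'_1 _] := p2p2'.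
have mD : measurable_fun [set: T * W] (fun z => Phi z.1 - PhiN z.1 z.2)%R.
  by apply: measurable_funB => //; exact: measurableT_comp.
have mDu u : measurable_fun [set: W] (fun w => Phi u - PhiN u w)%R.
  exact: (measurable_fun_pair2 u mD).
set Z := evidence mu0 Phi in ydens *.
have Z0 : (0 < Z)%R.
  rewrite lt_neqAle fine_ge0 ?andbT; last first.
    by apply: expectation_ge0 => u; exact: expR_ge0.
  (* If Z were 0, the convention 0^-1 = 0 would make the posterior density vanish, contradicting
     total mass 1. *)
  apply/eqP => Z0; have := ydens _ measurableT.
  rewrite [in LHS](_ : muy setT = 1); last exact: probability_setT.
  under eq_integral do rewrite /posterior_density -/Z -Z0 invr0 mul0r.
  by rewrite integral0 => /eqP; rewrite eqe oner_eq0.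
have [z zE z0] : exists2 z : R, marginal_evidence mu0 P PhiN = z%:E & (0 < z)%R.
  by case: (marginal_evidence _ _ _) ZN0 ZNoo => [z| |]//; exists z.
pose L u := marginal_lik P PhiN u.
have L0 u : 0 <= L u by apply: expectation_ge0 => w; exact: expR_ge0.
have LE u : L u = \int[P]_w (expR (- PhiN u w))%:E.
  by rewrite /L /marginal_lik unlock.
have mL : measurable_fun [set: T] L.
  rewrite (_ : L = fubini_F P (fun z => (expR (- PhiN z.1 z.2))%:E)).
    apply: measurable_fun_fubini_tonelli_F.
      by apply/measurable_EFinP; do 2 apply: measurableT_comp => //.
    by move=> u; rewrite lee_fin expR_ge0.
  by apply/funext => u; rewrite LE.
(* The prior mean of [L] is the marginal evidence, which is finite. *)
have Lfin : \forall u \ae mu0, L u \is a fin_num.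
  have iL : mu0.-integrable [set: T] L.
    apply/integrableP; split=> //.
    under eq_integral do rewrite gee0_abs//.
    by rewrite -/(marginal_evidence mu0 P PhiN).
  by apply: filterS (integrable_ae measurableT iL) => u; apply.
pose rho u : \bar R := (Z^-1 * expR (- Phi u))%:E.
have rho0 u : 0 <= rho u by rewrite lee_fin mulr_ge0 ?expR_ge0// invr_ge0 ltW.
have mrho : measurable_fun [set: T] rho.
  by apply/measurable_EFinP/measurable_funM => //;
    do 2 apply: measurableT_comp => //.
(* The quotient of L / Z_N by exp(-Phi) / Z, with z = Z_N. *)
pose r u : R := (z^-1 * Z * expR (Phi u) * fine (L u))%R.
have r0 u : (0 <= r u)%R.
  apply: mulr_ge0; last exact: fine_ge0.
  by rewrite mulr_ge0 ?expR_ge0// mulr_ge0 ?invr_ge0 ?ltW.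
have mr : measurable_fun [set: T] r.
  apply: measurable_funM; last exact: measurableT_comp.
  by apply: measurable_funM => //; exact: measurableT_comp.
have rdens : has_density muy muyN (EFin \o r).
  move=> A mA.
  have mr' : measurable_fun [set: T] (EFin \o r) by exact/measurable_EFinP.
  rewrite (integral_density mrho rho0 ydens mA mr' r0) Ndens//;
    apply: ae_eq_integral => //.
  - exact/measurable_funTS/emeasurable_funM.
  - by apply/measurable_funTS/emeasurable_funM => //; exact/measurable_EFinP.
  - apply: filterS Lfin => u Lu _.
    rewrite /marginal_density zE inver gt_eqF// -/(L u) -[in LHS](fineK Lu)
      -!EFinM.
    congr EFin; rewrite /r expRN; field.
    by rewrite !gt_eqF ?expR_gt0.
have r1 : \int[muy]_u (r u)%:E = 1.
  by rewrite -(rdens _ measurableT); exact: probability_setT.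
pose X u : R := fine (\int[P]_w (expR (Phi u - PhiN u w))%:E).
have intE u : \int[P]_w (expR (Phi u - PhiN u w))%:E = (expR (Phi u))%:E * L u.
  rewrite LE -ge0_integralZl//.
  - by apply: eq_integral => w _; rewrite expRD EFinM.
  - apply/measurable_EFinP; apply: measurableT_comp => //;
      apply: measurableT_comp => //.
    exact: (measurable_fun_pair2 u mPhiN).
(* Also valid where L u = +oo, since then both sides are 0 (fine +oo = 0). *)
have XE u : X u = (z / Z * r u)%R.
  rewrite /X intE /r; transitivity (expR (Phi u) * fine (L u))%R; last first.
    by field; rewrite !gt_eqF.
  by case: (L u) (L0 u) => [l| |]//= _;
    rewrite gt0_muley ?lte_fin ?expR_gt0//= mulr0.
have mX : measurable_fun [set: T] X.
  by rewrite (funext XE); exact: measurable_funM.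
have aeX : \forall u \ae muy, (`|1 - X u|)%:E <=
    'N[P]_p2'[ (fun w => (`|Phi u - PhiN u w|%R)%:E) ] *
    (1 + 'N[P]_p2[ (fun w => (expR (Phi u - PhiN u w))%:E) ]).
  (* A set negligible for the prior is negligible for the posterior, which has a density with
     respect to it. *)
  have [B [mB B0 sub]] := Lfin.
  exists B; split => //.
    by rewrite [LHS](ydens _ mB); apply: null_set_integral => //;
      exact: measurable_funTS.
  apply: subset_trans sub => u /=; apply: contra_not => Lu.
  apply: le_abs_1B_integral_expR => //.
  by rewrite intE fin_numM.
have mh : measurable_fun [set: T]
    (fun u => 'N[P]_p2'[ (fun w => (`|Phi u - PhiN u w|%R)%:E) ]).
  apply: (measurable_Lnorm_section P
    (f := fun z => (`|Phi z.1 - PhiN z.1 z.2|%R)%:E)) => //.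
  by apply/measurable_EFinP; exact: measurableT_comp.
have mg : measurable_fun [set: T]
    (fun u => 'N[P]_p2[ (fun w => (expR (Phi u - PhiN u w))%:E) ]).
  apply: (measurable_Lnorm_section P
    (f := fun z => (expR (Phi z.1 - PhiN z.1 z.2))%:E)) => //.
  by apply/measurable_EFinP; exact: measurableT_comp.
have m1X : measurable_fun [set: T] (fun u => 1 - X u)%R.
  exact: measurable_funB.
have := integral_sqr_le_Lnorm p1p1' C0 mh mg m1X gC aeX.
set N := 'N[muy]_(2%:E * p1')[_] => bound.
rewrite (hellinger_density muynu muyNnu mr r0 rdens).
have N0 : 0 <= (1 + C)%:E * N.
  by rewrite mule_ge0 ?lee_fin ?addr_ge0// Lnorm_ge0.
rewrite -[leRHS]gee0_abs// -sqrte_sqr lee_sqrt; last by rewrite expe2 mule_ge0.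
rewrite lee_pdivrMl//.
(* Here s = sqrt (Z_N / Z), so that s^2 r = X. The factor 2 cancels the 1/2 of the Hellinger
   distance. *)
apply: le_trans (integral_1Bsqrt_le (Num.sqrt (z / Z)) mr r0 r1) _.
rewrite lee_pmul2l//; apply: le_trans bound.
have zZ : (0 <= z / Z)%R by rewrite divr_ge0// ltW.
have sE u : (Num.sqrt (z / Z) * Num.sqrt (r u) = Num.sqrt (X u))%R.
  by rewrite XE (sqrtrM _ zZ).
apply: ge0_le_integral => //.
- by move=> u _; rewrite lee_fin sqr_ge0.
- apply/measurable_EFinP/measurable_funX/measurable_funB => //.
  by apply: measurable_funM => //; exact: measurable_fun_sqrt.
- exact/measurable_EFinP/measurable_funX.
- move=> u _; rewrite lee_fin sE.
  apply: le_trans (le_sqr_1Bsqr (sqrtr_ge0 _)) _.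
  by rewrite sqr_sqrtr// XE mulr_ge0.
Qed.

Theorem theorem2 (R : realType) :
  (* the constant depends on C1, C2 and Z only *)
  exists C : R -> R -> R -> R,
  forall (U : completeNormedModType R) (dy : nat) (G : U -> 'cV[R]_dy)
    (Gamma : 'M[R]_dy) (y : 'cV[R]_dy) (mu0 : probability (borel U) R)
    (dW : nat -> measure_display) (W : forall N : nat, measurableType (dW N))
    (P : forall N : nat, probability (W N) R)
    (PhiN : forall N : nat, U -> W N -> R)
    (muy : probability (borel U) R)
    (muyN : nat -> probability (borel U) R)
    (p1 p1' p2 p2' : \bar R) (C1 C2 : R),
  let Phi : borel U -> R := neg_log_lik Gamma y G in
  let Z : R := evidence mu0 Phi in
  let ZN (N : nat) : \bar R := marginal_evidence mu0 (P N) (PhiN N) in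
  separable_space U ->
  continuous G ->
  sympos_def Gamma ->
  (forall N : nat,
    measurable_fun [set: borel U * W N] (fun z => PhiN N z.1 z.2)) ->
  has_density mu0 muy (posterior_density mu0 Phi) ->
  (forall N : nat,
    has_density mu0 (muyN N) (marginal_density mu0 (P N) (PhiN N))) ->
  conjugate_exponents p1 p1' ->
  conjugate_exponents p2 p2' ->
  (0 <= C1)%R ->
  (0 <= C2)%R ->
  (forall N : nat,
    Lnorm_sup muy (2%:E * p1)
      (fun u => 'N[P N]_p2[ (fun w => (expR (Phi u - PhiN N u w))%:E) ])
    <= C1%:E) ->
  (forall N : nat, C2%:E^-1 <= ZN N /\ ZN N <= C2%:E) ->
  forall (N : nat) (nu : {sigma_finite_measure set (borel U) -> \bar R}),
    muy `<< nu -> muyN N `<< nu ->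
    hellinger nu muy (muyN N) <=
    (C C1 C2 Z)%:E *
    'N[muy]_(2%:E * p1')
      [ (fun u => 'N[P N]_p2'[ (fun w => (`|Phi u - PhiN N u w|%R)%:E) ]) ].
Proof.
exists (fun C1 _ _ => 1 + C1)%R.
move=> U dy G Gamma y mu0 dW W P PhiN muy muyN p1 p1' p2 p2' C1 C2 Phi Z ZN.
move=> _ cG _ mPhiN ydens Ndens p1p1' p2p2' C10 C20 gC1 ZNC2 N nu muynu muyNnu.
apply: (hellinger_marginal_le (p1 := p1) (p2 := p2) (mu0 := mu0)) => //.
- exact: measurable_neg_log_lik.
(* The extended inverse of [C2] is positive even for [C2 = 0], where it is [+oo]. *)
- have [ZNlo ZNhi] := ZNC2 N.
  rewrite (le_lt_trans ZNhi (ltry _)) andbT; apply: lt_le_trans ZNlo.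
  by rewrite lt_neqAle inve_ge0 lee_fin C20 andbT eq_sym inve_eq0.
(* The supremum of hypothesis (i) dominates the essential supremum used in the estimates. *)
- exact: le_trans (Lnorm_le_Lnorm_sup _ _ _) (gC1 N).
Qed.
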